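(* Let $p$ be an odd prime. The group $\mathcal{B}(F_2D_{2p})$ generated by the bicyclic units and the unitary subgroup $\mathcal{U}_*(F_2D_{2p})$ are normal subgroups of $\mathcal{U}(F_2D_{2p})$.
   Context: $D_{2p} = \langle a, b \mid a^p = 1,\ b^2 = 1,\ b^{-1}ab = a^{-1}\rangle$ is the dihedral group of order $2p$, $F_2$ is the field with two elements, and $\mathcal{U}(F_2D_{2p})$ is the unit group of the group algebra $F_2D_{2p}$. The canonical involution $*$ of $F_2D_{2p}$ is the linear extension of $g\mapsto g^{-1}$, $g\in D_{2p}$; the unitary subgroup is $\mathcal{U}_*(F_2D_{2p}) = \{u\in\mathcal{U}(F_2D_{2p}) : u^* = u^{-1}\}$. For $g,h\in D_{2p}$ with $g$ of order $n$, put $\widehat{g} = 1+g+\cdots+g^{n-1}$; the unit $u_{g,h} = 1+(g-1)h\widehat{g}$ is called a bicyclic unit, and $\mathcal{B}(F_2D_{2p})$ is the subgroup of $\mathcal{U}(F_2D_{2p})$ generated by all bicyclic units. *)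

(* Defs.v *)
From HB Require Import structures.
From mathcomp Require Import all_boot all_order all_algebra.
From mathcomp Require Import all_fingroup all_solvable.

Set Implicit Arguments.
Unset Strict Implicit.
Unset Printing Implicit Defensive.

Import GRing.Theory.
Local Open Scope ring_scope.

(* A record rather than an alias of {ffun gT -> R}, so that the pointwise     *)
(* product of finite functions can never be inferred instead of convolution.  *)
Record group_algebra (R : nzRingType) (gT : finGroupType) :=
  GroupAlgebra { ga_coef :> {ffun gT -> R} }.

Arguments group_algebra (R gT)%_type.

Section GroupAlgebraRing.

Variables (R : nzRingType) (gT : finGroupType).
Local Notation A := (group_algebra R gT).
Implicit Types (x y z : A) (g h : gT).

HB.instance Definition _ := [isNew for @ga_coef R gT].
HB.instance Definition _ := [Choice of A by <:].

Definition ga_gen (f : gT -> R) : A := GroupAlgebra (finfun f).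

Lemma ga_genE f g : ga_gen f g = f g.
Proof. by rewrite ffunE. Qed.

Lemma ga_ext x y : (forall g, x g = y g) -> x = y.
Proof. by move=> eq_xy; apply/val_inj/ffunP. Qed.

Definition ga_zero : A := ga_gen (fun=> 0).
Definition ga_opp x : A := ga_gen (fun g => - x g).
Definition ga_add x y : A := ga_gen (fun g => x g + y g).

Fact ga_addA : associative ga_add.
Proof. by move=> x y z; apply: ga_ext => g; rewrite !ga_genE addrA. Qed.
Fact ga_addC : commutative ga_add.
Proof. by move=> x y; apply: ga_ext => g; rewrite !ga_genE addrC. Qed.
Fact ga_add0 : left_id ga_zero ga_add.
Proof. by move=> x; apply: ga_ext => g; rewrite !ga_genE add0r. Qed.
Fact ga_addN : left_inverse ga_zero ga_opp ga_add.
Proof. by move=> x; apply: ga_ext => g; rewrite !ga_genE addNr. Qed.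

HB.instance Definition _ :=
  GRing.isZmodule.Build A ga_addA ga_addC ga_add0 ga_addN.

Lemma ga_coef0 g : (0 : A) g = 0.
Proof. exact: ga_genE. Qed.
Lemma ga_coefN x g : (- x) g = - x g.
Proof. exact: ga_genE. Qed.
Lemma ga_coefD x y g : (x + y) g = x g + y g.
Proof. exact: ga_genE. Qed.
Lemma ga_coef_sum I (r : seq I) (P : pred I) (F : I -> A) g :
  (\sum_(i <- r | P i) F i) g = \sum_(i <- r | P i) F i g.
Proof.
by apply: (big_morph (fun x : A => x g) _ (ga_coef0 g)) => x y; exact: ga_coefD.
Qed.

Definition ga_elt h : A := ga_gen (fun g => (g == h)%:R).

Lemma ga_eltE h g : ga_elt h g = (g == h)%:R.
Proof. exact: ga_genE. Qed.

Definition ga_mul x y : A := ga_gen (fun g => \sum_h x h * y (h^-1 * g)%g).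

Fact ga_mulA : associative ga_mul.
Proof.
move=> x y z; apply: ga_ext => g; rewrite !ga_genE.
under eq_bigr => h _ do rewrite ga_genE mulr_sumr.
under [RHS]eq_bigr => k _ do rewrite ga_genE mulr_suml.
rewrite [RHS]exchange_big; apply: eq_bigr => h _ /=.
rewrite [RHS](reindex_inj (mulgI h)); apply: eq_bigr => k _.
by rewrite mulKg invMg mulgA mulrA.
Qed.

Fact ga_mul1 : left_id (ga_elt 1) ga_mul.
Proof.
move=> x; apply: ga_ext => g; rewrite ga_genE (bigD1 1%g) //= big1.
  by rewrite ga_eltE eqxx mul1r invg1 mul1g addr0.
by move=> h /negPf nh; rewrite ga_eltE nh mul0r.
Qed.

Fact ga_1mul : right_id (ga_elt 1) ga_mul.
Proof.
move=> x; apply: ga_ext => g; rewrite ga_genE (bigD1 g) //= big1.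
  by rewrite ga_eltE mulVg eqxx mulr1 addr0.
by move=> h /negPf nh; rewrite ga_eltE -eq_mulVg1 nh mulr0.
Qed.

Fact ga_mulDl : left_distributive ga_mul ga_add.
Proof.
move=> x y z; apply: ga_ext => g; rewrite !ga_genE -big_split /=.
by apply: eq_bigr => h _; rewrite ga_genE mulrDl.
Qed.

Fact ga_mulDr : right_distributive ga_mul ga_add.
Proof.
move=> x y z; apply: ga_ext => g; rewrite !ga_genE -big_split /=.
by apply: eq_bigr => h _; rewrite ga_genE mulrDr.
Qed.

Fact ga_1_neq0 : ga_elt 1 != 0.
Proof.
apply/eqP => /(congr1 (fun x : A => x 1%g)) /eqP.
by rewrite ga_eltE ga_coef0 eqxx oner_eq0.
Qed.

HB.instance Definition _ := GRing.Zmodule_isNzRing.Build A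
  ga_mulA ga_mul1 ga_1mul ga_mulDl ga_mulDr ga_1_neq0.

Lemma ga_coefM x y g : (x * y) g = \sum_h x h * y (h^-1 * g)%g.
Proof. exact: ga_genE. Qed.

Lemma ga_elt1 : ga_elt 1 = 1.
Proof. by []. Qed.

Lemma ga_eltM : {morph ga_elt : g h / (g * h)%g >-> g * h}.
Proof.
move=> g h; apply: ga_ext => k; rewrite ga_coefM (bigD1 g) //= big1.
  by rewrite !ga_eltE eqxx mul1r addr0 (can2_eq (mulKVg g) (mulKg g)).
by move=> l /negPf nl; rewrite ga_eltE nl mul0r.
Qed.

Lemma ga_eltX g n : ga_elt (g ^+ n) = ga_elt g ^+ n.
Proof. by elim: n => // n IHn; rewrite expgS exprS ga_eltM IHn. Qed.

Definition ga_scale (a : R) x : A := ga_gen (fun g => a * x g).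

Fact ga_scaleA a b x : ga_scale a (ga_scale b x) = ga_scale (a * b) x.
Proof. by apply: ga_ext => g; rewrite !ga_genE mulrA. Qed.
Fact ga_scale1 : left_id 1 ga_scale.
Proof. by move=> x; apply: ga_ext => g; rewrite ga_genE mul1r. Qed.
Fact ga_scaleDr : right_distributive ga_scale +%R.
Proof.
by move=> a x y; apply: ga_ext => g; rewrite ga_coefD !ga_genE mulrDr.
Qed.
Fact ga_scaleDl x : {morph ga_scale^~ x : a b / a + b}.
Proof.
by move=> a b; apply: ga_ext => g; rewrite ga_coefD !ga_genE mulrDl.
Qed.

HB.instance Definition _ := GRing.Zmodule_isLmodule.Build R A
  ga_scaleA ga_scale1 ga_scaleDr ga_scaleDl.

Lemma ga_coefZ a x g : (a *: x) g = a * x g.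
Proof. exact: ga_genE. Qed.

Fact ga_scaleAl a x y : a *: (x * y) = (a *: x) * y.
Proof.
apply: ga_ext => g; rewrite ga_coefZ !ga_coefM mulr_sumr.
by apply: eq_bigr => h _; rewrite ga_coefZ mulrA.
Qed.

HB.instance Definition _ := GRing.Lmodule_isLalgebra.Build R A ga_scaleAl.

Lemma ga_sum_elt x : x = \sum_g x g *: ga_elt g.
Proof.
apply: ga_ext => g; rewrite ga_coef_sum (bigD1 g) // big1.
  by rewrite ga_coefZ ga_eltE eqxx mulr1 /= addr0.
by move=> h nh; rewrite ga_coefZ ga_eltE eq_sym (negPf nh) mulr0.
Qed.

Definition ga_star x : A := \sum_g x g *: ga_elt g^-1.

Lemma ga_starE x g : ga_star x g = x g^-1%g.
Proof.
rewrite ga_coef_sum (bigD1 g^-1%g) // big1.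
  by rewrite ga_coefZ ga_eltE invgK eqxx mulr1 /= addr0.
move=> h /negPf nh.
by rewrite ga_coefZ ga_eltE eq_sym (can2_eq (@invgK _) (@invgK _)) nh mulr0.
Qed.

Lemma ga_star_elt g : ga_star (ga_elt g) = ga_elt g^-1.
Proof.
apply: ga_ext => h; rewrite ga_starE !ga_eltE.
by rewrite (can2_eq (@invgK _) (@invgK _)).
Qed.

Lemma ga_star1 : ga_star 1 = 1.
Proof. by rewrite -ga_elt1 ga_star_elt invg1. Qed.

Definition ga_hat g : A := \sum_(i < #[g]%g) ga_elt g ^+ i.

Definition bicyclic g h : A := 1 + (ga_elt g - 1) * ga_elt h * ga_hat g.

Lemma ga_hat_sub1 g : ga_hat g * (ga_elt g - 1) = 0.
Proof.
have cgh : ga_elt g * ga_hat g = ga_hat g * ga_elt g.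
  rewrite /ga_hat mulr_sumr mulr_suml; apply: eq_bigr => i _.
  by rewrite -exprS exprSr.
rewrite mulrBr mulr1 -cgh -{2}[ga_hat g]mul1r -mulrBl /ga_hat.
by rewrite -subrX1 -ga_eltX expg_order ga_elt1 subrr.
Qed.

End GroupAlgebraRing.

Arguments ga_elt R {gT} h%_g.
Arguments ga_hat R {gT} g%_g.
Arguments bicyclic R {gT} (g h)%_g.

Section GroupAlgebraCom.

Variables (R : comNzRingType) (gT : finGroupType).
Local Notation A := (group_algebra R gT).
Implicit Types (x y : A) (g h : gT).

Fact ga_scaleAr a x y : a *: (x * y) = x * (a *: y).
Proof.
apply: ga_ext => g; rewrite ga_coefZ !ga_coefM mulr_sumr.
by apply: eq_bigr => h _; rewrite ga_coefZ mulrCA.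
Qed.

HB.instance Definition _ := GRing.Lalgebra_isAlgebra.Build R A ga_scaleAr.

Lemma ga_starM x y : ga_star (x * y) = ga_star y * ga_star x.
Proof.
apply: ga_ext => g; rewrite ga_starE !ga_coefM.
rewrite (reindex_inj (mulgI g^-1%g)); apply: eq_bigr => h _ /=.
by rewrite !ga_starE mulrC !invMg !invgK mulgK.
Qed.

End GroupAlgebraCom.

Section GroupAlgebraFin.

Variables (R : finNzRingType) (gT : finGroupType).

HB.instance Definition _ := [Finite of group_algebra R gT by <:].
HB.instance Definition _ := FinRing.isNzRing.Build (group_algebra R gT).

End GroupAlgebraFin.

Section UnitSubgroups.

Variables (F : finFieldType) (gT : finGroupType).
Local Notation A := (group_algebra F gT).
Implicit Types (g h : gT) (u v : {unit A}).

Fact bicyclic_is_unit g h : (bicyclic F g h) \is a GRing.unit.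
Proof.
pose y : A := (ga_elt F g - 1) * ga_elt F h * ga_hat F g.
have yy : y * y = 0.
  by rewrite /y -!mulrA [ga_hat F g * _]mulrA ga_hat_sub1 mul0r !mulr0.
apply/unitrP; exists (1 - y); rewrite /bicyclic -/y.
split; rewrite !(mulrDl, mulrDr, mul1r, mulr1, mulrN, mulNr) yy subr0.
  by rewrite ?subrK ?addrK.
by rewrite ?subrK ?addrK.
Qed.

Definition bicyclic_unit g h : {unit A} :=
  FinRing.unit A (bicyclic_is_unit g h).

Definition bicyclic_group : {group {unit A}} :=
  <<[set bicyclic_unit g h | g : gT, h : gT]>>%G.

Definition unitary_set : {set {unit A}} :=
  [set u : {unit A} | ga_star (val u) == val (u^-1)%g].

Fact unitary_group_set : group_set unitary_set.
Proof.
apply/group_setP; split=> [|u v]; first by rewrite inE invg1 ga_star1.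
rewrite !inE => /eqP uu /eqP vv.
by rewrite invMg !FinRing.val_unitM ga_starM uu vv.
Qed.

Definition unitary_group : {group {unit A}} := Group unitary_group_set.

End UnitSubgroups.

Arguments bicyclic_unit F {gT} (g h)%_g.
Arguments bicyclic_group (F gT)%_type.
Arguments unitary_set (F gT)%_type.
Arguments unitary_group (F gT)%_type.

(* Main.v *)
Require Import Defs.
From mathcomp Require Import all_boot all_order all_algebra.
From mathcomp Require Import all_fingroup all_solvable.

(** Let [G] be generated by [a] of odd order and an involution [b] inverting
    [a]. Write [L] for the commutative subalgebra spanned by the rotations; every
    element of the algebra is [y0 + y1 b] with [y0], [y1] in [L], and
    [b y = y^* b] for [y] in [L]. Symmetric elements of [L] are therefore
    central.

    Unitary subgroup. In characteristic 2 the cross terms of [u u^*] cancel, so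
    [u u^*] is a symmetric element of [L], hence central ([norm_central]): on the
    2 x 2 matrix components of the algebra, [*] is the adjugate and [u u^*] is
    the determinant. Thus [u^*] is a central multiple of [u^-1], and conjugation
    by [u] commutes with [*] ([unitary_normal]).

    Bicyclic subgroup. A bicyclic unit [u_{g,h}] with [g] a rotation is 1. For a
    reflection [g], put [N = 1 + g]; then [N^2 = 0] and [u_{g,h} = 1 + N h N].
    These transvections multiply by adding their middle terms, so over [F_2] the
    bicyclic group contains [1 + N x N] for every [x] in the algebra
    ([bicyclic_transvection]). For a unit [u], [u^-1 = u^* d] with [d] central,
    and [N u = N y] for some [y] in [L], so the conjugate of [1 + N x N] by [u] is
    [1 + y^* (N d x N) y]. Everything reduces to [twisted_transvection]: such an
    element is a product of transvections, for all [y] in [L] and all [x].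

    On matrices, [N] is nilpotent of rank one and the claim is that the elementary
    transvections generate all transvections. Over a field one would split
    [y = s + e a] with central [s], [e] and distinguish [e = 0], where
    [1 + y^* (N x N) y] is again a transvection along [N], from [e] invertible,
    where up to scaling [y] is [s / e + a], and conjugating by a suitable
    [1 + c N] clears [s / e]. Here the scalars form only a product of fields, but
    there is an [m] with [x ^+ m.+3 = x] on all of [L] ([rotation_regular]):
    powers provide both the idempotents [e ^+ m.+2] that separate the two cases
    and the partial inverses [e ^+ m.+1], without decomposing the algebra. *)

Set Implicit Arguments.
Unset Strict Implicit.
Unset Printing Implicit Defensive.

Import GRing.Theory.
Local Open Scope ring_scope.

Local Notation "x ^*" := (ga_star x) : ring_scope.

(** * Transvections built on a square-zero element *)

Section Sandwich.

Variables (R : nzRingType) (n : R).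
Implicit Types (c e s x y z : R).

Definition central c := forall z, c * z = z * c.

Lemma sandwichM y' y x1 x2 : n * n = 0 -> central (y * y') ->
  (1 + y' * (n * x1 * n) * y) * (1 + y' * (n * x2 * n) * y)
    = 1 + y' * (n * (x1 + x2) * n) * y.
Proof.
move=> n0 cy; rewrite mulrDl mul1r [X in _ + X]mulrDr mulr1.
have -> : y' * (n * x1 * n) * y * (y' * (n * x2 * n) * y)
    = y' * n * x1 * (n * (y * y') * n) * x2 * n * y by rewrite !mulrA.
have -> : n * (y * y') * n = 0 by rewrite -cy -mulrA n0 mulr0.
rewrite !(mulr0, mul0r) addr0.
by rewrite -addrA [X in _ + X]addrC -mulrDl -mulrDr -mulrDl -mulrDr.
Qed.

(** The part of a twisted transvection on which [e] vanishes: only [s] is seen,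
    and being central it can be moved inside. *)
Lemma sandwich_annihilated e s a' a x : central e -> central s -> x * e = 0 ->
  (s + a' * e) * (n * x * n) * (s + e * a) = n * (s * x * s) * n.
Proof.
move=> ce cs xe0.
have nxne : n * x * n * e = 0.
  by rewrite -mulrA -ce -mulrA [x * (_ * _)]mulrA xe0 mul0r mulr0.
have enxn : e * (n * x * n) = 0 by rewrite ce.
have -> : (s + a' * e) * (n * x * n) = s * (n * x * n).
  by rewrite mulrDl -[a' * e * _]mulrA enxn mulr0 addr0.
rewrite mulrDr [_ * (e * a)]mulrA -[s * _ * e]mulrA nxne mulr0 mul0r addr0.
by rewrite -!mulrA -(cs n) !mulrA -(cs n).
Qed.

(** The part on which [e] is invertible: [e ^+ m.+2] is the idempotent supporting
    [e], and [e ^+ m.+1] is the inverse of [e] there, so that [s + e a] becomes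
    [e] times [e ^+ m.+1 * s + a]; the factors [e] are absorbed in the middle. *)
Lemma sandwich_regular e s a' a x m : central e -> e ^+ m.+3 = e ->
  (s + a' * e) * (n * (x * e ^+ m.+2) * n) * (s + e * a)
    = (e ^+ m.+1 * s + a') * (n * (e * x * e) * n) * (e ^+ m.+1 * s + a).
Proof.
move=> ce em.
have cX k : central (e ^+ k).
  by move=> z; apply/esym/commrX/esym/ce.
(* One copy of the idempotent is used up on each side. *)
pose f := e ^+ m.+2; have cf : central f := cX m.+2.
have ff : f * f = f by rewrite -exprD addSnnS exprD em -exprSr.
have left_f : (s + a' * e) * f = (e ^+ m.+1 * s + a') * e.
  by rewrite !mulrDl -mulrA -exprS em /f exprSr mulrA -[s * _]cX.
have right_f : f * (s + e * a) = e * (e ^+ m.+1 * s + a).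
  by rewrite !mulrDr mulrA -exprSr em mulrA -exprS.
rewrite -/f; clearbody f.
have -> : n * (x * f) * n = f * (n * x * n) * f.
  rewrite -{1}ff [x * (_ * _)]mulrA -[x * f]cf !mulrA -[n * f]cf.
  rewrite -[LHS]mulrA -[RHS]mulrA.
  by congr (_ * _); apply: cf.
rewrite -[f * _ * f]mulrA mulrA left_f -[LHS]mulrA -[_ * f * _]mulrA right_f.
rewrite -[RHS]mulrA -[LHS]mulrA; congr (_ * _).
rewrite !mulrA; congr (_ * _).
by rewrite -[n * e]ce -[LHS]mulrA -[RHS]mulrA; congr (_ * _); rewrite ce.
Qed.

(** Conjugating by the involution [1 + c n] translates the row [n a] by a
    multiple of [n], because [n a n = t n]; a multiple of [n] that is divisible
    by [t] can thus be removed. *)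
Lemma sandwich_conj c g t a' a z :
    n * n = 0 -> c + c = 0 -> central c -> central g -> c * t = g ->
    n * a' * n = t * n -> n * a * n = t * n ->
  1 + (g + a') * (n * z * n) * (g + a)
    = (1 + c * n) * (1 + a' * (n * z * n) * a) * (1 + c * n).
Proof.
move=> n0 c0 cc cg ct na'n nan; set v := 1 + c * n.
have vv : v * v = 1.
  rewrite mulrDl mul1r mulrDr mulr1 -[c * n * _]mulrA [n * _]mulrA -cc.
  rewrite -[c * n * n]mulrA n0.
  by rewrite !mulr0 addr0 -addrA -mulrDl c0 mul0r addr0.
have nav : n * (g + a) = n * a * v.
  rewrite !mulrDr mulr1 -cg addrC [n * a * _]mulrA -[n * a * c]cc.
  by rewrite -mulrA nan mulrA ct.
have va'n : (g + a') * n = v * (a' * n).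
  by rewrite !mulrDl mul1r addrC -[c * n * _]mulrA [n * _]mulrA na'n mulrA ct.
rewrite [X in _ = X * _]mulrDr mulr1 [RHS]mulrDl vv; congr (1 + _).
by rewrite !mulrA va'n -[LHS]mulrA nav !mulrA.
Qed.

(** The coefficient [c] to be used in [sandwich_conj] for
    [g = e ^+ m.+1 * s]. It is written as a multiple of [u], which will be the
    trace of [y]: for such [c], [c n] has the form [n x n]. *)
Lemma central_regular_solve e s t u m :
    central e -> u * t ^+ m.+1 = e -> e * t ^+ m.+2 = e ->
  u * (t ^+ m.+1 * (e ^+ m * s) * t ^+ m.+1) * t = e ^+ m.+1 * s.
Proof.
rewrite (exprSr t m.+1) (exprS e m); move: (t ^+ m.+1) (e ^+ m) => t1 f ce ut et.
by rewrite !mulrA ut -(mulrA _ t1) -[e * f * s]mulrA ce -mulrA et -ce.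
Qed.

(** If [u' d] is the inverse of [u], the left side is the conjugate by [u] of the
    nilpotent part of a transvection. *)
Lemma sandwich_intertwine d u' y' u y x :
    central d -> u' * n = y' * n -> n * u = n * y ->
  u' * d * (n * x * n) * u = y' * (n * (d * x) * n) * y.
Proof.
move=> cd yn ny; rewrite !mulrA -[LHS]mulrA ny -(mulrA u' d n) cd.
by rewrite !mulrA yn.
Qed.

Lemma central_inverse c d : central c -> c * d = 1 -> central d.
Proof.
move=> cc cd x; have dc : d * c = 1 by rewrite -cc.
rewrite -[LHS]mulr1 -cd -[d * x * _]mulrA [x * _]mulrA -(cc x).
by rewrite !mulrA dc mul1r.
Qed.

End Sandwich.

(** * The canonical involution *)

Section Involution.

Variables (F : comNzRingType) (gT : finGroupType).
Implicit Types (x y : group_algebra F gT).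

Lemma ga_starK : involutive (@ga_star F gT).
Proof. by move=> x; apply: ga_ext => g; rewrite !ga_starE invgK. Qed.

Lemma ga_starD x y : (x + y)^* = x^* + y^*.
Proof. by apply: ga_ext => g; rewrite ga_coefD !ga_starE ga_coefD. Qed.

Lemma ga_starZ c x : (c *: x)^* = c *: x^*.
Proof. by apply: ga_ext => g; rewrite ga_coefZ !ga_starE ga_coefZ. Qed.

Lemma ga_star0 : (0 : group_algebra F gT)^* = 0.
Proof. by apply: ga_ext => g; rewrite ga_starE !ga_coef0. Qed.

End Involution.

(** * Rotations and reflections in characteristic two *)

Section RotationAlgebra.

Variables (F : finFieldType) (gT : finGroupType) (a b : gT).
Hypothesis charF : 2 \in [pchar F].
Hypothesis b2 : (b * b = 1)%g.
Hypothesis aJb : (a ^ b = a^-1)%g.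
Hypothesis genG :
  forall g, exists2 k, k \in <[a]>%g & g = k \/ g = (k * b)%g.

Local Notation A := (group_algebra F gT).
Local Notation "[ g ]" := (ga_elt F g) (at level 0, format "[ g ]").
Implicit Types (u x y z : A).

(** The span of the powers of [a], presented as the image of a polynomial ring:
    commutativity and stability under the ring operations come for free, and
    polynomial induction applies. *)
Definition rotation_elt x := exists q, x = horner_alg [a] q.

Lemma rotation_ind (K : A -> Prop) :
    K 0 -> (forall x c, rotation_elt x -> K x -> K (x * [a] + c%:A)) ->
  forall x, rotation_elt x -> K x.
Proof.
move=> K0 KS x [q ->]; elim/poly_ind: q => [|q c IHq]; first by rewrite rmorph0.
rewrite rmorphD rmorphM /= horner_algX horner_algC.
by apply: KS IHq; exists q.
Qed.

Lemma rotationD x y :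
  rotation_elt x -> rotation_elt y -> rotation_elt (x + y).
Proof. by case=> p -> [q ->]; exists (p + q); rewrite rmorphD. Qed.

Lemma rotationM x y :
  rotation_elt x -> rotation_elt y -> rotation_elt (x * y).
Proof. by case=> p -> [q ->]; exists (p * q); rewrite rmorphM. Qed.

Lemma rotationZ c x : rotation_elt x -> rotation_elt (c *: x).
Proof.
case=> p ->; exists (c%:P * p).
by rewrite rmorphM /= horner_algC -scalerAl mul1r.
Qed.

Lemma rotation1 : rotation_elt 1.
Proof. by exists 1; rewrite rmorph1. Qed.

Lemma rotation0 : rotation_elt 0.
Proof. by exists 0; rewrite rmorph0. Qed.

Lemma rotationX x n : rotation_elt x -> rotation_elt (x ^+ n).
Proof. by case=> p ->; exists (p ^+ n); rewrite rmorphXn. Qed.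

Lemma rotation_comm x y : rotation_elt x -> rotation_elt y -> x * y = y * x.
Proof. by case=> p -> [q ->]; rewrite -!rmorphM mulrC. Qed.

Lemma rotation_group g : g \in <[a]>%g -> rotation_elt [g].
Proof.
case/cycleP=> i ->; rewrite ga_eltX; apply: rotationX.
by exists 'X; rewrite horner_algX.
Qed.

Lemma rotation_gen : rotation_elt [a].
Proof. exact/rotation_group/cycle_id. Qed.

Lemma rotation_star x : rotation_elt x -> rotation_elt x^*.
Proof.
move: x; apply: rotation_ind => [|x c _ rx].
  by rewrite ga_star0; apply: rotation0.
rewrite ga_starD ga_starM ga_starZ ga_star1 ga_star_elt.
apply: rotationD; last exact/rotationZ/rotation1.
by apply: rotationM => //; apply: rotation_group; rewrite groupV cycle_id.
Qed.

Lemma reflection_swap x : rotation_elt x -> [b] * x = x^* * [b].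
Proof.
move: x; apply: rotation_ind => [|x c rx IHx].
  by rewrite ga_star0 mulr0 mul0r.
rewrite mulrDr mulrA IHx ga_starD ga_starM ga_starZ ga_star1 ga_star_elt mulrDl.
rewrite -mulrA -ga_eltM; congr (_ + _).
  have -> : (b * a = a^-1 * b)%g.
    by rewrite [RHS]conjgC conjVg aJb invgK.
  rewrite ga_eltM mulrA; congr (_ * _); apply: rotation_comm.
    exact: rotation_star.
  by apply: rotation_group; rewrite groupV cycle_id.
by rewrite -scalerAr -scalerAl mulr1 mul1r.
Qed.

Lemma rotation_decomp x :
  exists y0 y1, [/\ rotation_elt y0, rotation_elt y1 & x = y0 + y1 * [b]].
Proof.
rewrite [x]ga_sum_elt.
elim/big_ind: _ => [|u v [y0 [y1 [r0 r1 ->]]] [z0 [z1 [s0 s1 ->]]] | g _].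
- by exists 0, 0; rewrite mul0r addr0; split=> //; apply: rotation0.
- exists (y0 + z0), (y1 + z1); split; [exact: rotationD | exact: rotationD |].
  by rewrite mulrDl addrACA.
have [k /rotation_group rk [->|->]] := genG g.
  exists (x k *: [k]), 0; rewrite mul0r addr0.
  by split=> //; [exact: rotationZ | exact: rotation0].
exists 0, (x (k * b)%g *: [k]); rewrite add0r ga_eltM scalerAl.
by split=> //; [exact: rotation0 | exact: rotationZ].
Qed.

Lemma rotation_sym_central z : rotation_elt z -> z^* = z -> central z.
Proof.
move=> rz sz x; have [y0 [y1 [r0 r1 ->]]] := rotation_decomp x.
rewrite mulrDr mulrDl (rotation_comm rz r0); congr (_ + _).
rewrite mulrA (rotation_comm rz r1) -!mulrA; congr (_ * _).
by rewrite reflection_swap // sz.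
Qed.

Lemma addff x : x + x = 0.
Proof.
by rewrite -mulr2n -scaler_nat -[2%:R]/(2%:R) (pcharf0 charF) scale0r.
Qed.

(** For [u = y0 + y1 b], the two cross terms of [u u^*] are both [y0 y1 b] and
    cancel; what remains is [y0 y0^* + y1 y1^*]. *)
Lemma norm_central u : central (u * u^*).
Proof.
have [y0 [y1 [r0 r1 ->]]] := rotation_decomp u.
have bV : (b^-1 = b)%g by apply/eqP; rewrite eq_invg_mul b2.
have bb : [b] * [b] = 1 by rewrite -ga_eltM b2.
rewrite ga_starD ga_starM ga_star_elt bV (reflection_swap (rotation_star r1)).
rewrite ga_starK mulrDl !mulrDr (mulrA y0) (rotation_comm r0 r1).
have -> : y1 * [b] * y0^* = y1 * y0 * [b].
  by rewrite -mulrA (reflection_swap (rotation_star r0)) ga_starK mulrA.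
have -> : y1 * [b] * (y1 * [b]) = y1 * y1^*.
  by rewrite mulrA -(mulrA y1) reflection_swap // -!mulrA bb mulr1.
rewrite -addrA [X in _ + X]addrA addff add0r.
apply: rotation_sym_central; last by rewrite ga_starD !ga_starM !ga_starK.
by apply: rotationD; apply: rotationM => //; apply: rotation_star.
Qed.

(** Since [z = u u^*] is central, [u^* = u^-1 z] and [z (u^-1)^* = u], so the two
    factors [z] cancel in the image under [*] of a conjugate by [u]. *)
Lemma unitary_normal :
  (unitary_group F gT <| [set: {unit A}])%g.
Proof.
apply/normalP; split=> [|u _]; first exact: subsetT.
apply/eqP; rewrite eqEcard cardJg leqnn andbT.
apply/subsetP=> _ /imsetP[v uv ->].
move: uv; rewrite !inE => /eqP vv; rewrite -conjVg !conjgE !FinRing.val_unitM.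
have uV : val u^-1%g * val u = 1 by rewrite -FinRing.val_unitM mulVg.
have zu : (val u * (val u)^*) * (val u^-1%g)^* = val u.
  by rewrite -mulrA -ga_starM uV ga_star1 mulr1.
rewrite !ga_starM vv -{2}zu [val v^-1%g * (_ * _)]mulrA -norm_central.
by rewrite -mulrA !mulrA uV mul1r.
Qed.

Let N := 1 + [b].

Lemma reflN_absorbl : [b] * N = N.
Proof. by rewrite mulrDr mulr1 -ga_eltM b2 addrC. Qed.

Lemma reflN_absorbr : N * [b] = N.
Proof. by rewrite mulrDl mul1r -ga_eltM b2 addrC. Qed.

Lemma reflN_sqr0 : N * N = 0.
Proof. by rewrite {1}/N mulrDl mul1r reflN_absorbl addff. Qed.

Lemma reflN_star : N^* = N.
Proof.
have bV : (b^-1 = b)%g by apply/eqP; rewrite eq_invg_mul b2.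
by rewrite ga_starD ga_star1 ga_star_elt bV.
Qed.

(** The sandwiched element is seen only through its trace [x + x^*], a central
    scalar. *)
Lemma reflN_sandwich x : rotation_elt x -> N * x * N = (x + x^*) * N.
Proof.
move=> rx; rewrite mulrDl mul1r reflection_swap // mulrDl -mulrA reflN_absorbl.
by rewrite mulrDl.
Qed.

Lemma reflN_mull x : exists2 y, rotation_elt y & N * x = N * y.
Proof.
have [y0 [y1 [r0 r1 ->]]] := rotation_decomp x.
exists (y0 + y1^*); first exact/rotationD/rotation_star.
rewrite !mulrDr; congr (_ + _).
rewrite -[in RHS]reflN_absorbr -mulrA (reflection_swap (rotation_star r1)).
by rewrite ga_starK.
Qed.

(** The traces form the principal ideal generated by the trace of [a]: this is
    the recursion expressing [a^i + a^-i] through [a + a^-1]. *)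
Lemma trace_gen y : rotation_elt y ->
  exists2 r, rotation_elt r & y + y^* = r * ([a] + [a]^*).
Proof.
move: y; apply: rotation_ind => [|x c rx [r rr eq_r]].
  by exists 0; [exact: rotation0 | rewrite ga_star0 addr0 mul0r].
exists (x + r * [a^-1]).
  apply: rotationD => //; apply/rotationM/rotation_group => //.
  by rewrite groupV cycle_id.
rewrite ga_starD ga_starM ga_starZ ga_star1 addrACA addff addr0 ga_star_elt.
have rV : rotation_elt [a^-1] by apply: rotation_group; rewrite groupV cycle_id.
rewrite mulrDl -mulrA (rotation_comm rV); last first.
  by apply: rotationD rV; apply: rotation_gen.
rewrite mulrA -(ga_star_elt F a) -eq_r ga_star_elt.
rewrite mulrDr mulrDl -addrA; congr (_ + _).
rewrite addrA addff add0r; apply: rotation_comm rV _.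
exact: rotation_star.
Qed.

End RotationAlgebra.

(** * Bicyclic units over the field with two elements *)

Section BicyclicTransvections.

Variable gT : finGroupType.
Local Notation F := 'F_2.
Local Notation A := (group_algebra F gT).
Local Notation "[ g ]" := (ga_elt F g) (at level 0, format "[ g ]").
Local Notation N g := (1 + [g]).
Implicit Types (x y z : A) (g h k : gT) (v : {unit A}).

Definition bicyclic_elt x := exists2 v, v \in bicyclic_group F gT & val v = x.

Lemma bicyclic_eltM x y :
  bicyclic_elt x -> bicyclic_elt y -> bicyclic_elt (x * y).
Proof.
case=> u Bu <- [v Bv <-]; exists (u * v)%g; first exact: groupM.
exact: FinRing.val_unitM.
Qed.

Lemma bicyclic_elt1 : bicyclic_elt 1.
Proof. by exists 1%g; rewrite ?group1. Qed.

(** Moving [g - 1] across [h] turns it into [g ^ h - 1], which kills the sum of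
    the powers of [g] as soon as [g ^ h] is one of these powers. *)
Lemma bicyclic_trivial g h : (g ^ h \in <[g]>)%g -> bicyclic F g h = 1.
Proof.
case/cycleP=> i eq_gh; rewrite /bicyclic.
have absorb k : k \in <[g]>%g -> [k] * ga_hat F g = ga_hat F g.
  case/cycleP=> j ->; elim: j => [|j IHj]; first by rewrite ga_elt1 mul1r.
  have cgh : ga_hat F g * [g] = ga_hat F g.
    by apply/eqP; rewrite -subr_eq0 -[X in _ - X]mulr1 -mulrBr ga_hat_sub1.
  rewrite expgSr ga_eltM -mulrA.
  have -> : [g] * ga_hat F g = ga_hat F g * [g].
    rewrite /ga_hat mulr_sumr mulr_suml; apply: eq_bigr => l _.
    by rewrite -exprS exprSr.
  by rewrite cgh.
have -> : ([g] - 1) * [h] = [h] * ([(g ^ h)%g] - 1).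
  by rewrite mulrBl mulrBr mul1r mulr1 -!ga_eltM conjgC.
by rewrite -mulrA mulrBl mul1r absorb ?eq_gh ?mem_cycle // subrr mulr0 addr0.
Qed.

Lemma oppF2 x : - x = x.
Proof. by apply/eqP; rewrite eq_sym -addr_eq0 addff // pchar_Fp. Qed.

Lemma bicyclic_involution g h :
  #[g]%g = 2 -> bicyclic F g h = 1 + N g * [h] * N g.
Proof.
move=> og; rewrite /bicyclic /ga_hat og !big_ord_recl big_ord0 addr0 oppF2.
by rewrite expr0 expr1 [_ + 1]addrC.
Qed.

(** The product of two transvections along [1 + g] adds their middle terms, and
    over [F_2] every element of the algebra is a sum of group elements. *)
Lemma bicyclic_transvection g x :
  #[g]%g = 2 -> bicyclic_elt (1 + N g * x * N g).
Proof.
move=> og; have g2 : (g * g = 1)%g by rewrite -(expg_order g) og.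
have charF : 2 \in [pchar F] by apply: pchar_Fp.
rewrite [x]ga_sum_elt; elim/big_ind: _ => [|y z By Bz|h _].
- by rewrite mulr0 mul0r addr0; apply: bicyclic_elt1.
- have -> : 1 + N g * (y + z) * N g
      = (1 + N g * y * N g) * (1 + N g * z * N g).
    have c1 : central (1 * 1 : A) by move=> w; rewrite !mulr1 mul1r.
    have := sandwichM y z (reflN_sqr0 charF g2) c1.
    by move: (N g) => n; rewrite !mul1r !mulr1 => ->.
  exact: bicyclic_eltM.
have [->|->] : x h = 0 \/ x h = 1.
- by case: (x h) => [[|[|//]] lt]; [left | right]; apply: val_inj.
- by rewrite scale0r mulr0 mul0r addr0; apply: bicyclic_elt1.
rewrite scale1r -bicyclic_involution //.
by exists (bicyclic_unit F g h) => //; apply/mem_gen/imset2P; exists g h.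
Qed.

End BicyclicTransvections.

(** * Normality of the bicyclic group *)

Section DihedralBicyclic.

Variables (gT : finGroupType) (a b : gT).
Hypothesis odd_a : odd (#[a]%g).
Hypothesis b2 : (b * b = 1)%g.
Hypothesis aJb : (a ^ b = a^-1)%g.
Hypothesis genG :
  forall g, exists2 k, k \in <[a]>%g & g = k \/ g = (k * b)%g.

Local Notation F := 'F_2.
Local Notation A := (group_algebra F gT).
Local Notation "[ g ]" := (ga_elt F g) (at level 0, format "[ g ]").
Local Notation N := (1 + [b]).
Local Notation rot := (@rotation_elt F gT a).
Implicit Types (x y z : A) (g h k : gT).

Let charF : 2 \in [pchar F] := pchar_Fp (isT : prime 2).

(** For [q] a power of 2 congruent to 1 modulo the odd order of [a], the [q]-th
    power map is additive, fixes the coefficients and fixes [a]. The exponent is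
    written [m.+3] so that [x ^+ m.+2] is idempotent while [x ^+ m.+1] is still a
    multiple of [x]. *)
Lemma rotation_regular : exists m, forall x, rot x -> x ^+ m.+3 = x.
Proof.
(* Doubling the exponent ensures 3 <= q even when a is trivial. *)
pose q := (2 ^ (totient #[a]%g).*2)%N.
have q4 : (4 <= q)%N.
  rewrite -[4%N]/(2 ^ 2)%N leq_exp2l // -[2%N]/(1.*2)%N leq_double.
  by rewrite totient_gt0.
have q0 : (q == 0)%N = false by rewrite gtn_eqF // (leq_trans _ q4).
have aq : (a ^+ q = a)%g.
  apply/eqP; rewrite -[X in _ == X]expg1 eq_expg_mod_order.
  rewrite /q -muln2 expnM -modnXm Euler_exp_totient ?modnXm ?exp1n //.
  by rewrite coprime_sym coprimen2.
have pcharP : 2 \in [pchar {poly F}] by rewrite (rmorph_pchar (@polyC F)).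
have qP : [pchar {poly F}].-nat q.
  by rewrite pnatX (eq_pnat _ (pcharf_eq pcharP)) pnat_id.
clearbody q; exists (q - 3)%N => x; rewrite -addn3 subnK 1?ltnW //.
case=> p ->; rewrite -rmorphXn.
elim/poly_ind: p => [|p c IHp]; first by rewrite expr0n q0.
have cq : c ^+ q = c.
  have [->|->] : c = 0 \/ c = 1.
  - by case: c => [[|[|//]] lt]; [left | right]; apply: val_inj.
  - by rewrite expr0n q0.
  by rewrite expr1n.
rewrite (exprDn_pchar _ _ qP) exprMn -polyC_exp cq !rmorphD !rmorphM /= IHp.
by rewrite rmorphXn /= horner_algX -ga_eltX aq.
Qed.

Definition rot_sym z := rot z /\ z^* = z.

Lemma rot_sym_central z x : rot_sym z -> z * x = x * z.
Proof. by case=> rz sz; apply: (rotation_sym_central aJb genG rz sz). Qed.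

Lemma rot_symM y z : rot_sym y -> rot_sym z -> rot_sym (y * z).
Proof.
case=> ry sy sz; split; first by case: sz => rz _; apply: rotationM.
by case: (sz) => _ eq_z; rewrite ga_starM sy eq_z (rot_sym_central _ sz).
Qed.

Lemma rot_symX z n : rot_sym z -> rot_sym (z ^+ n).
Proof.
move=> sz; elim: n => [|n IHn]; last by rewrite exprS; apply: rot_symM.
by split; [apply: rotation1 | apply: ga_star1].
Qed.

Lemma rot_sym_trace y : rot y -> rot_sym (y + y^*).
Proof.
move=> ry; split; first exact/rotationD/rotation_star.
by rewrite ga_starD ga_starK addrC.
Qed.

(** [1] and [a] span [L] over its symmetric part, with the coefficient [e] of [a]
    determined by [y + y^* = e t], where [t = a + a^*]; this can be solved
    because [t ^+ m.+1] inverts [t] on the ideal that [t] generates. *)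
Lemma rotation_basis y m (t := [a] + [a]^*) :
    (forall x, rot x -> x ^+ m.+3 = x) -> rot y ->
  exists e s, [/\ rot_sym e, rot_sym s, y = s + e * [a],
    (y + y^*) * t ^+ m.+1 = e & e * t ^+ m.+2 = e].
Proof.
move=> reg ry; pose e := (y + y^*) * t ^+ m.+1; exists e, (y + e * [a]).
have ra := rotation_gen F a.
have st : rot_sym t by apply: rot_sym_trace.
have se : rot_sym e by apply/rot_symM/rot_symX/st; apply: rot_sym_trace.
have [r rr eq_r] := trace_gen charF ry; rewrite -/t in eq_r.
have et : e * t = y + y^*.
  by rewrite /e eq_r -!mulrA -exprSr -exprS reg //; case: st.
split=> //; last first.
- have -> : e * t ^+ m.+2 = e * t * t ^+ m.+1 by rewrite -mulrA -exprS.
  by rewrite et.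
- by rewrite -addrA addff ?addr0.
split; first by apply/rotationD/rotationM => //; case: se.
have ta : y + e * [a] + (y^* + e * [a]^*) = 0.
  by rewrite addrACA -mulrDr -/t et addff.
rewrite ga_starD ga_starM; case: (se) => _ ->.
rewrite -(rot_sym_central _ se).
by move/eqP: ta; rewrite addrC addr_eq0 oppF2 => /eqP.
Qed.

Hypothesis ob : #[b]%g = 2.

(** The case distinction on [e] in [y = s + e a], carried out by splitting [x]
    along the idempotent [e ^+ m.+2]. *)
Lemma twisted_transvection x y : rot y ->
  bicyclic_elt (1 + y^* * (N * x * N) * y).
Proof.
move=> ry; have [m reg] := rotation_regular.
have [e [s [se ss Dy et ete]]] := rotation_basis reg ry.
have ce : central e by move=> z; apply: rot_sym_central.
have cs : central s by move=> z; apply: rot_sym_central.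
have Dys : y^* = s + [a]^* * e.
  by rewrite {1}Dy ga_starD ga_starM; case: ss se => _ -> [_ ->].
have em : e ^+ m.+3 = e by apply: reg; case: se.
have N0 := reflN_sqr0 charF b2.
have -> : x = x * e ^+ m.+2 + (x + x * e ^+ m.+2).
  by rewrite addrCA (addff charF) addr0.
rewrite -sandwichM //; last exact: norm_central charF b2 aJb genG y.
apply: bicyclic_eltM; last first.
  (* Here the middle term is annihilated by e. *)
  rewrite Dys [in X in _ * X]Dy sandwich_annihilated //.
    exact: bicyclic_transvection.
  by rewrite mulrDl -mulrA -exprSr em (addff charF).
(* On the support of e, conjugate a transvection along 1 + b ^ a by 1 + c N. *)
rewrite Dys [in X in _ * X]Dy sandwich_regular //.
have Nt z :
    rot z -> z + z^* = [a] + [a]^* -> N * z * N = ([a] + [a]^*) * N.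
  by move=> rz <-; exact: (reflN_sandwich b2 aJb rz).
have st : rot_sym ([a] + [a]^*) by apply/rot_sym_trace/rotation_gen.
have Na := Nt _ (rotation_gen F a) (erefl _).
have Na' : N * [a]^* * N = ([a] + [a]^*) * N.
  by apply: Nt; [apply/rotation_star/rotation_gen | rewrite ga_starK addrC].
move: ([a] + [a]^*) st et ete Na Na' {Nt} => t st et ete Na Na'.
pose k := t ^+ m.+1 * (e ^+ m * s) * t ^+ m.+1.
have sk : rot_sym k.
  by do ![apply: rot_symM]; rewrite //; apply: rot_symX.
set c := (y + y^*) * k.
have sc : rot_sym c by apply: rot_symM sk; apply: rot_sym_trace.
have ct : c * t = e ^+ m.+1 * s by exact: central_regular_solve ce et ete.
clearbody k.
rewrite (sandwich_conj _ N0 (addff charF _) _ _ ct Na' Na); first last.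
- by move=> z; apply/rot_sym_central/rot_symM => //; apply: rot_symX.
- by move=> z; apply: rot_sym_central.
have Bc : bicyclic_elt (1 + c * N).
  have -> : c * N = N * (y * k) * N; last exact: bicyclic_transvection.
  case: (sk) => rk eq_k.
  rewrite (reflN_sandwich b2 aJb (rotationM ry rk)).
  rewrite ga_starM eq_k (rot_sym_central _ sk).
  by rewrite -mulrDl.
apply: bicyclic_eltM (Bc); apply: bicyclic_eltM; first exact: Bc.
move: (e * x * e) => z.
have -> : [a]^* * (N * z * N) * [a]
    = (1 + [(b ^ a)%g]) * ([a]^* * z * [a]) * (1 + [(b ^ a)%g]).
  have Nb : N * [a] = [a] * (1 + [(b ^ a)%g]).
    by rewrite mulrDl mulrDr mul1r mulr1 -!ga_eltM conjgC.
  have aN : [a]^* * N = (1 + [(b ^ a)%g]) * [a]^*.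
    rewrite ga_star_elt mulrDl mulrDr mul1r mulr1 -!ga_eltM.
    by rewrite conjgE !mulgA mulgK.
  by rewrite !mulrA aN -mulrA Nb !mulrA.
by apply: bicyclic_transvection; rewrite orderJ.
Qed.

Lemma bicyclic_conj_reflection h (u : {unit A}) :
  (bicyclic_unit F b h ^ u)%g \in bicyclic_group F gT.
Proof.
have uV : val u^-1%g * val u = 1 by rewrite -FinRing.val_unitM mulVg.
have Vu : val u * val u^-1%g = 1 by rewrite -FinRing.val_unitM mulgV.
have cz := norm_central charF b2 aJb genG (val u).
have [v Bv eq_v] : bicyclic_elt (val u^-1%g * bicyclic F b h * val u).
  rewrite bicyclic_involution // mulrDr mulrDl mulr1 uV.
  move: (val u) (val u^-1%g) uV Vu cz => {}u w wu uw cz.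
  have uwst : u^* * w^* = 1 by rewrite -ga_starM wu ga_star1.
  have zV : u * u^* * (w^* * w) = 1.
    by rewrite -mulrA [u^* * _]mulrA uwst mul1r.
  have cV := central_inverse cz zV.
  have Dw : w = u^* * (w^* * w) by rewrite mulrA uwst mul1r.
  have [y ry Ny] := reflN_mull b2 aJb genG u.
  have yN : u^* * N = y^* * N.
    by move/(congr1 (@ga_star F gT)): Ny; rewrite !ga_starM (reflN_star F b2).
  rewrite {1}Dw (sandwich_intertwine _ cV yN Ny).
  exact: twisted_transvection.
suff -> : (bicyclic_unit F b h ^ u)%g = v by [].
by apply: val_inj; rewrite eq_v conjgE !FinRing.val_unitM mulrA.
Qed.

End DihedralBicyclic.

(** Every [k * b] other than 1, with [k] in [<[a]>], can play the part of [b], so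
    it is enough to conjugate the bicyclic units attached to [b]. *)
Lemma bicyclic_normal (gT : finGroupType) (a b : gT) :
    odd (#[a]%g) -> (b * b = 1)%g -> (a ^ b = a^-1)%g ->
    (forall g, exists2 k, k \in <[a]>%g & g = k \/ g = (k * b)%g) ->
  (bicyclic_group 'F_2 gT <| [set: {unit group_algebra 'F_2 gT}])%g.
Proof.
move=> odd_a b2 aJb genG; rewrite /normal subsetT; apply/subsetP=> u _.
rewrite inE -genJ gen_subG.
apply/subsetP=> _ /imsetP[_ /imset2P[g h _ _ ->] ->].
have trivial_conj : (g ^ h \in <[g]>)%g ->
    (bicyclic_unit 'F_2 g h ^ u)%g \in bicyclic_group 'F_2 gT.
  move/(bicyclic_trivial (gT := gT)) => gh1.
  have -> : bicyclic_unit 'F_2 g h = 1%g by apply: val_inj.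
  by rewrite conj1g group1.
have [k ak [Dg | Dg]] := genG g; rewrite {g}Dg in trivial_conj *.
  apply: trivial_conj; have [l al [-> | ->]] := genG h.
    by rewrite conjgE (centsP (cycle_abelian a) k ak l al) mulKg cycle_id.
  rewrite conjgM [(k ^ l)%g]conjgE (centsP (cycle_abelian a) k ak l al) mulKg.
  by case/cycleP: ak => i ->; rewrite conjXg aJb expgVn groupV cycle_id.
have [kb1 | kb_neq1] := eqVneq (k * b)%g 1%g.
  by apply: trivial_conj; rewrite kb1 conj1g group1.
have kJb : (k ^ b = k^-1)%g.
  by case/cycleP: ak => i ->; rewrite conjXg aJb expgVn.
have bV : (b^-1 = b)%g by apply/eqP; rewrite eq_invg_mul b2.
have kb2 : (k * b * (k * b) = 1)%g.
  by rewrite -mulgA -{1}bV -conjgE kJb mulgV.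
apply: (@bicyclic_conj_reflection gT a (k * b)%g) => //.
- rewrite conjgM [(a ^ k)%g]conjgE -(centsP (cycle_abelian a) k ak) ?mulKg //.
  exact: cycle_id.
- move=> g; have [l al [-> | ->]] := genG g; first by exists l => //; left.
  exists (l * k^-1)%g; first by rewrite groupMr ?groupV.
  by right; rewrite mulgA mulgKV.
by apply: nt_prime_order.
Qed.

Lemma dihedral_generators p : (1 < p)%N -> exists a b : 'D_(p.*2),
  [/\ (a ^+ p = 1)%g, (b * b = 1)%g, (a ^ b = a^-1)%g
    & forall g, exists2 k, k \in <[a]>%g & g = k \/ g = (k * b)%g].
Proof.
move=> p1.
have /existsP[[a b] /eqP[defG ap b2 aJb]] := isoGrp_hom (Grp_dihedral p1).
exists a, b; split=> // g.
have nab : (<[b]> \subset 'N(<[a]>))%g.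
  by rewrite norms_cycle aJb groupV cycle_id.
have : g \in [set: 'D_(p.*2)] by rewrite inE.
rewrite -defG norm_joinEr // => /mulsgP[k _ ak /cycleP[i ->] ->]; exists k => //.
rewrite -(expg_mod i b2).
have : (i %% 2 < 2)%N by rewrite ltn_mod.
case: (i %% 2)%N => [|[|//]] _; [left | right].
- by rewrite mulg1.
- by rewrite expg1.
Qed.

Theorem corollary8 (p : nat) (p_prime : prime p) (p_odd : odd p) :
  (bicyclic_group 'F_2 'D_(p.*2)
     <| [set: {unit (group_algebra 'F_2 'D_(p.*2))}])%g
  /\ (unitary_group 'F_2 'D_(p.*2)
        <| [set: {unit (group_algebra 'F_2 'D_(p.*2))}])%g.
Proof.
have [a [b [ap b2 aJb genG]]] := dihedral_generators (prime_gt1 p_prime).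
split.
  apply: bicyclic_normal b2 aJb genG; apply: dvdn_odd p_odd.
  by rewrite order_dvdn ap.
exact: unitary_normal (pchar_Fp (isT : prime 2)) b2 aJb genG.
Qed.
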